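(* Fix a pointed affine semigroup $S = \operatorname{Sg}(A) \subset \mathbb{Z}^d$ given by $|A| = k$ generators. If $k \ge d(r-1)+1$, then there exists an $r$-coloring of $S$ such that some element $p \in S$ has a monochromatic solution of every color.
   Context: For an integer matrix $A$ with $d$ rows and $k$ columns (the generators), $\operatorname{Sg}(A) = \{Ax : x \in \mathbb{Z}^k,\ x \ge 0\}$ is the affine semigroup of all non-negative integer combinations of the columns of $A$. An affine semigroup is pointed if it has no nontrivial subgroups; equivalently, the cone of all non-negative real combinations of its generators contains no positive-dimensional linear subspace. An $r$-coloring of $S = \operatorname{Sg}(A)$ assigns to each column of $A$ one of $r$ colors, giving a partition $\mathcal{I}_1,\ldots,\mathcal{I}_r$ of the column indices, where $\mathcal{I}_i$ is the set of indices of columns of color $i$. An element $p \in S$ has a monochromatic solution of color $i$ if there is $x \in \mathbb{Z}^k$, $x \ge 0$, with $Ax = p$ whose support (the set of indices $j$ with $x_j \ne 0$) is contained in $\mathcal{I}_i$. *)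

(* Defs.v *)
From HB Require Import structures.
From mathcomp Require Import all_boot all_order all_algebra.
From mathcomp Require Import boolp classical_sets.

Set Implicit Arguments.
Unset Strict Implicit.
Unset Printing Implicit Defensive.

Import Order.TTheory GRing.Theory Num.Theory.
Local Open Scope ring_scope.

Definition nonneg_vec (k : nat) (x : 'cV[int]_k) : Prop :=
  forall j : 'I_k, 0 <= x j 0.

Definition Sg (d k : nat) (A : 'M[int]_(d, k)) : set 'cV[int]_d :=
  [set p | exists2 x : 'cV[int]_k, nonneg_vec x & A *m x = p]%classic.

(* The only idempotent of Z^d is 0, so the subgroups of the semigroup S are
   exactly the subgroups of Z^d contained in S. *)
Definition pointed_semigroup (d : nat) (S : set 'cV[int]_d) : Prop :=
  forall H : set 'cV[int]_d,
    zmod_closed (mem H) -> (H `<=` S)%classic -> H = [set 0]%classic.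

Definition vec_support (k : nat) (x : 'cV[int]_k) : {set 'I_k} :=
  [set j | x j 0 != 0]%SET.

(* A coloring is a map c : 'I_k -> 'I_r; some colors may be unused. *)
Definition color_class (k r : nat) (c : 'I_k -> 'I_r) (i : 'I_r) : {set 'I_k} :=
  [set j | c j == i]%SET.

Definition has_monochromatic_solution (d k r : nat) (A : 'M[int]_(d, k))
    (c : 'I_k -> 'I_r) (i : 'I_r) (p : 'cV[int]_d) : Prop :=
  exists x : 'cV[int]_k,
    [/\ nonneg_vec x, A *m x = p & vec_support x \subset color_class c i].

(* Main.v *)
Require Import Defs.
From HB Require Import structures.
From mathcomp Require Import all_boot all_order all_algebra.
From mathcomp Require Import boolp classical_sets.
From mathcomp Require Import ring lra.

Set Implicit Arguments.
Unset Strict Implicit.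
Unset Printing Implicit Defensive.

Import Order.TTheory GRing.Theory Num.Theory.
Local Open Scope ring_scope.

(** The statement is the conic form of Tverberg's theorem, together with the
    remark that pointedness keeps the common point away from the origin.

    Write [r = s + 1]. By [conic_tverberg], [k > d s] vectors of a
    [d]-dimensional space over an ordered field can be colored with [r] colors
    and given non-negative weights of sum 1, so that the weighted sums of the
    color classes coincide. This follows by Sarkaria's tensor trick from
    [colorful_caratheodory]: if each of [n > m] finite families in
    [m]-dimensional space has the origin in its convex hull, then one vector can
    be chosen in each family so that the origin is in the convex hull of the
    chosen vectors. The proof of the latter is Barany's: a choice whose hull is
    closest to the origin contains the origin, since otherwise one of the
    vectors can be exchanged for a better one.

    Integer solutions are needed in the end, so all this is carried out over
    the rational numbers, where the point of minimal norm of a polytope has to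
    be obtained by algebra instead of compactness: that is
    [min_norm_simplex].

    Clearing denominators yields integer vectors [y_i >= 0], supported on the
    color classes, with the same image [p] under [A]. If [p = 0], then their
    sum [x] satisfies [A x = 0], and [x] has a positive coordinate; by
    [pointed_kernel] a generator vanishes. *)

(** * Euclidean norms over an ordered field *)

Definition dot (F : realFieldType) (n : nat) (x y : 'rV[F]_n) : F :=
  (x *m y^T) 0 0.

Definition sqnorm (F : realFieldType) (n : nat) (x : 'rV[F]_n) : F := dot x x.

Lemma dotC (F : realFieldType) n (x y : 'rV[F]_n) : dot x y = dot y x.
Proof. by rewrite /dot -[y in RHS]trmxK -trmx_mul [RHS]mxE. Qed.

Lemma dotDl (F : realFieldType) n (x y z : 'rV[F]_n) :
  dot (x + y) z = dot x z + dot y z.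
Proof. by rewrite /dot mulmxDl mxE. Qed.

Lemma dotZl (F : realFieldType) n a (x y : 'rV[F]_n) :
  dot (a *: x) y = a * dot x y.
Proof. by rewrite /dot -scalemxAl mxE. Qed.

Lemma dot_suml (F : realFieldType) n (I : finType) (x : I -> 'rV[F]_n) y :
  dot (\sum_i x i) y = \sum_i dot (x i) y.
Proof. by rewrite /dot mulmx_suml summxE. Qed.

Lemma sqnormE (F : realFieldType) n (x : 'rV[F]_n) :
  sqnorm x = \sum_i x 0 i ^+ 2.
Proof.
by rewrite /sqnorm /dot mxE; apply: eq_bigr => i _; rewrite mxE expr2.
Qed.

Lemma sqnorm_ge0 (F : realFieldType) n (x : 'rV[F]_n) : 0 <= sqnorm x.
Proof. by rewrite sqnormE sumr_ge0 // => i _; exact: sqr_ge0. Qed.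

Lemma sqnorm_eq0 (F : realFieldType) n (x : 'rV[F]_n) :
  (sqnorm x == 0) = (x == 0).
Proof.
apply/idP/eqP => [|->]; last by rewrite /sqnorm /dot mul0mx mxE.
rewrite sqnormE psumr_eq0 => [/allP x0|i _]; last exact: sqr_ge0.
apply/rowP => i; rewrite mxE; apply/eqP.
by rewrite -sqrf_eq0; apply: x0; rewrite mem_index_enum.
Qed.

Lemma sqnormDZ (F : realFieldType) n a (x y : 'rV[F]_n) :
  sqnorm (x + a *: y) = sqnorm x + 2 * a * dot x y + a ^+ 2 * sqnorm y.
Proof.
rewrite /sqnorm dotDl dotZl ![dot _ (x + _)]dotC !dotDl !dotZl [dot y x]dotC.
ring.
Qed.

(** * Points of minimal norm in polytopes *)

Lemma sum1_exists_neq0 (R : nzRingType) (I : finType) (f : I -> R) :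
  \sum_i f i = 1 -> exists i, f i != 0.
Proof.
move=> f1; have [//|f0] := pselect (exists i, f i != 0).
move/eqP: f1; rewrite big1 ?(eq_sym 0) ?oner_eq0 // => i _.
by apply/eqP/negPn/negP => fi; apply: f0; exists i.
Qed.

(** The coefficient vectors of the convex combinations of a family, carried by
    the members whose index lies in [J]: with the points as the rows of a matrix
    [U], the convex hull of those members is the set of the [l *m U]. *)
Definition simplex (F : realFieldType) (n : nat) (J : {set 'I_n})
    (l : 'rV[F]_n) : Prop :=
  [/\ forall j, 0 <= l 0 j, \sum_j l 0 j = 1
    & forall j, j \notin J -> l 0 j = 0].

Lemma simplex_vertex (F : realFieldType) n (J : {set 'I_n}) k :
  k \in J -> simplex J (delta_mx 0 k : 'rV[F]_n).
Proof.
move=> kJ; split=> [j||j jJ].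
- by rewrite mxE ler0n.
- rewrite (bigD1 k) //= big1 => [|j /negPf jk]; last by rewrite mxE jk andbF.
  by rewrite mxE !eqxx addr0.
- by rewrite mxE; case: (j =P k) jJ => [->|_ _]; rewrite ?kJ ?andbF //.
Qed.

Lemma simplex_segment (F : realFieldType) n (J : {set 'I_n})
    (l l' : 'rV[F]_n) t :
  simplex J l -> simplex J l' -> 0 <= t -> t <= 1 ->
  simplex J (l + t *: (l' - l)).
Proof.
move=> [l_ge0 sl lJ] [l'_ge0 sl' l'J] t_ge0 t_le1; split=> [j||j jJ].
- rewrite !mxE; have := l_ge0 j; have := l'_ge0 j; nra.
- under eq_bigr do rewrite !mxE.
  by rewrite big_split /= -mulr_sumr sumrB sl sl' subrr mulr0 addr0.
- by rewrite !mxE lJ // l'J // subr0 mulr0 addr0.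
Qed.

(** Ratio test: following a direction [d] until the first coordinate vanishes
    leaves the positive orthant exactly on its boundary. *)
Lemma ratio_test (F : realFieldType) n (l d : 'rV[F]_n) i :
  (forall j, 0 <= l 0 j) -> d 0 i < 0 ->
  exists t, [/\ 0 <= t, forall j, 0 <= (l + t *: d) 0 j
    & exists2 k, d 0 k < 0 & (l + t *: d) 0 k = 0].
Proof.
move=> l_ge0 di.
case: (@Order.TotalTheory.arg_minP _ _ _ i [pred j | d 0 j < 0]
         (fun j => l 0 j / - d 0 j) di) => k /= dk mink.
exists (l 0 k / - d 0 k).
have t_ge0 : 0 <= l 0 k / - d 0 k.
  by rewrite divr_ge0 // ltW // oppr_gt0.
split=> // [j|]; last first.
  by exists k => //; rewrite !mxE; field; rewrite lt_eqF.
rewrite !mxE; have [dj|dj] := ltP (d 0 j) 0.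
  have := mink j dj; rewrite ler_pdivlMr ?oppr_gt0 // mulrN; lra.
by rewrite addr_ge0 // mulr_ge0.
Qed.

(** Minimizing [|l A|^2] on the hyperplane [l e = 1]: the second conclusion is
    the Lagrange condition. It is solvable because the Gram matrix [A A^T] and
    [A] have the same left kernel, as [v A A^T = 0] forces [|v A|^2 = 0]. So
    either some [l] in that kernel has [l e <> 0], and [a = 0] works, or the
    kernel is orthogonal to [e], which puts [e^T] in the row space of the Gram
    matrix. *)
Lemma min_norm_hyperplane (F : realFieldType) n m (A : 'M[F]_(n, m))
    (e : 'cV[F]_n) :
  e != 0 -> exists2 l : 'rV[F]_n, l *m e = 1%:M
    & exists a, l *m A *m A^T = a *: e^T.
Proof.
move=> e_neq0.
have [[l lA le]|no_l] :=
  pselect (exists2 l : 'rV[F]_n, l *m A = 0 & l *m e != 0).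
  have le0 : (l *m e) 0 0 != 0.
    apply: contraNneq le => le0; apply/eqP.
    by rewrite [LHS]mx11_scalar le0 raddf0.
  exists (((l *m e) 0 0)^-1 *: l).
    by rewrite -scalemxAl [X in _ *: X]mx11_scalar scale_scalar_mx mulVf.
  by exists 0; rewrite -scalemxAl lA scaler0 mul0mx scale0r.
have /submxP[l lG] : (e^T <= A *m A^T)%MS.
  rewrite submxE -trmx_eq0; apply/eqP/row_matrixP => i.
  rewrite row0 trmx_mul trmxK row_mul.
  set v := row i _.
  have vG : v *m (A *m A^T) = 0.
    have -> : A *m A^T = (A *m A^T)^T by rewrite trmx_mul trmxK.
    by rewrite -row_mul -trmx_mul mulmx_coker trmx0 row0.
  have vA : v *m A = 0.
    apply/eqP; rewrite -sqnorm_eq0 /sqnorm /dot trmx_mul !mulmxA.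
    by rewrite -(mulmxA v) vG mul0mx mxE.
  by apply/eqP/negPn/negP => ve; apply: no_l; exists v.
have lle : (l *m e) 0 0 = sqnorm (l *m A).
  by rewrite /sqnorm /dot trmx_mul !mulmxA -(mulmxA l) -lG -trmx_mul [RHS]mxE.
have le0 : (l *m e) 0 0 != 0.
  rewrite lle sqnorm_eq0; apply: contraNneq e_neq0 => lA.
  by rewrite -trmx_eq0 lG mulmxA lA mul0mx.
exists (((l *m e) 0 0)^-1 *: l).
  by rewrite -scalemxAl [X in _ *: X]mx11_scalar scale_scalar_mx mulVf.
by exists ((l *m e) 0 0)^-1; rewrite lG -!scalemxAl mulmxA.
Qed.

(** The orthogonal projection of the origin onto the affine hull of the rows
    of [A] indexed by [J]: the last clause says that [l A] is orthogonal to all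
    differences between points of this hull. *)
Lemma min_norm_affine (F : realFieldType) n m (A : 'M[F]_(n, m))
    (J : {set 'I_n}) :
  J != finset.set0 -> exists l : 'rV[F]_n,
    [/\ \sum_j l 0 j = 1, forall j, j \notin J -> l 0 j = 0
      & forall l' : 'rV[F]_n, \sum_j l' 0 j = 1 ->
          (forall j, j \notin J -> l' 0 j = 0) ->
          dot (l *m A) (l' *m A) = sqnorm (l *m A)].
Proof.
move=> /finset.set0Pn[j0 j0J].
pose e : 'cV[F]_n := \col_j (j \in J)%:R.
have e_neq0 : e != 0.
  apply/eqP => /matrixP /(_ j0 0); rewrite !mxE j0J => /eqP.
  by rewrite oner_eq0.
(* Erasing the rows outside J turns the support condition on l into l = l P. *)
pose P := diag_mx e^T.
have Pl (l : 'rV[F]_n) j : (l *m P) 0 j = l 0 j * (j \in J)%:R.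
  by rewrite mul_mx_diag !mxE.
have PJ (l : 'rV[F]_n) : (forall j, j \notin J -> l 0 j = 0) -> l *m P = l.
  move=> lJ; apply/rowP => j; rewrite Pl.
  by case: (boolP (j \in J)) => [_|/lJ->]; rewrite ?mulr1 ?mul0r.
have [l le [a lP]] := min_norm_hyperplane (P *m A) e_neq0.
have sumP (l' : 'rV[F]_n) : (l' *m e) 0 0 = \sum_j (l' *m P) 0 j.
  by rewrite mxE; apply: eq_bigr => j _; rewrite Pl mxE.
have sumlP : \sum_j (l *m P) 0 j = 1 by rewrite -sumP le mxE.
have lPJ j : j \notin J -> (l *m P) 0 j = 0.
  by move=> /negPf jJ; rewrite Pl jJ mulr0.
have dotE (l' : 'rV[F]_n) : \sum_j l' 0 j = 1 ->
    (forall j, j \notin J -> l' 0 j = 0) -> dot (l *m P *m A) (l' *m A) = a.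
  move=> sl' l'J; rewrite -(PJ _ l'J) /dot -(mulmxA l') trmx_mul mulmxA.
  rewrite -(mulmxA l P) lP -scalemxAl mxE -trmx_mul mxE sumP PJ //.
  by rewrite sl' mulr1.
exists (l *m P); split=> // l' sl' l'J.
by rewrite /sqnorm !dotE.
Qed.

(** Compactness is not available over an arbitrary ordered field, so the nearest
    point is found by induction on the face. If the projection [z A] of the
    origin onto the affine hull has non-negative coefficients, it is the
    minimum. Otherwise, going from any point of the polytope straight to [z A]
    never increases the norm, and the polytope is left through a proper face on
    the way; so the best of the minima over the facets is the minimum. *)
Lemma min_norm_simplex (F : realFieldType) n m (A : 'M[F]_(n, m))
    (J : {set 'I_n}) :
  J != finset.set0 -> exists2 l : 'rV[F]_n, simplex J l
    & forall l', simplex J l' -> sqnorm (l *m A) <= sqnorm (l' *m A).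
Proof.
have [N] := ubnP #|J|; elim: N J => // N IHN J /ltnSE leJN J_neq0.
have [z [sz zJ zorth]] := min_norm_affine A J_neq0.
(* Pythagoras on the segment from l to z *)
have sqnormz l s : simplex J l ->
    sqnorm ((l + s *: (z - l)) *m A) =
    sqnorm (z *m A) + (1 - s) ^+ 2 * sqnorm ((l - z) *m A).
  move=> [_ sl lJ].
  have -> : l + s *: (z - l) = z + (1 - s) *: (l - z).
    apply/rowP => j; rewrite !mxE; ring.
  rewrite mulmxDl -scalemxAl sqnormDZ.
  suff -> : dot (z *m A) ((l - z) *m A) = 0 by ring.
  rewrite mulmxBl -scaleN1r dotC dotDl dotZl ![dot _ (z *m A)]dotC zorth //.
  by rewrite /sqnorm; ring.
have [z_ge0|/existsNP[i /negP]] := pselect (forall j, 0 <= z 0 j).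
  exists z => [//|l lS].
  have := sqnormz l 0 lS; rewrite scale0r addr0 => ->.
  by rewrite subr0 expr1n mul1r lerDl sqnorm_ge0.
rewrite -ltNge => zi.
(* Each point of the polytope is at least as long as some point of a facet. *)
have exit l : simplex J l -> exists2 k, k \in J & exists2 l',
    simplex (J :\ k) l' & sqnorm (l' *m A) <= sqnorm (l *m A).
  move=> lS; have [l_ge0 sl lJ] := lS.
  have di : (z - l) 0 i < 0 by rewrite !mxE; have := l_ge0 i; lra.
  have [t [t_ge0 lt_ge0 [k dk lk]]] := ratio_test l_ge0 di.
  have t_le1 : t <= 1.
    have := lt_ge0 i; have := l_ge0 i; rewrite !mxE; nra.
  exists k.
    by apply: contraTT dk => kJ; rewrite !mxE zJ // lJ // subr0 ltxx.
  exists (l + t *: (z - l)).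
    split=> // [|j].
      under eq_bigr do rewrite !mxE.
      by rewrite big_split /= -mulr_sumr sumrB sz sl subrr mulr0 addr0.
    rewrite !inE negb_and negbK => /orP[/eqP->//|jJ].
    by rewrite !mxE zJ // lJ // subr0 mulr0 addr0.
  rewrite sqnormz //.
  have := sqnormz l 0 lS; rewrite scale0r addr0 => ->.
  rewrite lerD2l ler_wpM2r ?sqnorm_ge0 // lerXn2r ?nnegrE; lra.
pose good k := (k \in J) && (J :\ k != finset.set0).
have /choice[f fP] : forall k, exists l : 'rV[F]_n, good k -> simplex (J :\ k) l
    /\ forall l', simplex (J :\ k) l' -> sqnorm (l *m A) <= sqnorm (l' *m A).
  move=> k; case: (boolP (good k)) => [/andP[kJ Jk]|_]; last by exists 0.
  have [|l lS lmin] := IHN (J :\ k) _ Jk; last by exists l.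
  by move: leJN; rewrite (cardsD1 k) kJ.
have goodP k (l : 'rV[F]_n) : k \in J -> simplex (J :\ k) l -> good k.
  move=> kJ [_ /sum1_exists_neq0[j lj] lJ]; rewrite /good kJ /=.
  by apply: contraNneq lj => J0; rewrite lJ // J0 inE.
have [j0 j0J] := finset.set0Pn _ J_neq0.
have vS := simplex_vertex F j0J.
have [k0 k0J [v' v'S _]] := exit _ vS.
case: (@Order.TotalTheory.arg_minP _ _ _ k0 good
  (fun k => sqnorm (f k *m A)) (goodP _ _ k0J v'S)) => k gk mink.
have [[fk_ge0 sfk fkJ] _] := fP k gk.
exists (f k).
  by split=> // j jJ; apply: fkJ; rewrite !inE (negPf jJ) andbF.
move=> l /exit[k' k'J [l' l'S le_l']].
have gk' := goodP _ _ k'J l'S.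
apply: le_trans (mink k' gk') _; apply: le_trans le_l'.
by have [_] := fP k' gk'; apply.
Qed.

(** * The colorful Caratheodory theorem *)

(** Moving from [x] towards [v] changes the squared norm by
    [- 2 t a + t^2 b] with [a = |x|^2 - <x, v> > 0] and [b = |v - x|^2]; over
    an arbitrary ordered field a step small enough must be given explicitly. *)
Lemma sqnorm_descent (F : realFieldType) n (x v : 'rV[F]_n) :
  dot x v < sqnorm x ->
  exists t, [/\ 0 <= t, t <= 1 & sqnorm (x + t *: (v - x)) < sqnorm x].
Proof.
move=> xv; set a := sqnorm x - dot x v; set b := sqnorm (v - x).
have a_gt0 : 0 < a by rewrite subr_gt0.
have b_ge0 : 0 <= b := sqnorm_ge0 _.
have ab_gt0 : 0 < a + b by rewrite ltr_wpDr.
(* The optimal step is a / b; this one is at most 1 and also fits b = 0. *)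
pose t := a / (a + b).
have t_gt0 : 0 < t by rewrite divr_gt0.
have tab : t * (a + b) = a by rewrite /t divfK ?gt_eqF.
exists t; split; first exact: ltW.
  by rewrite ler_pdivrMr // mul1r lerDl.
rewrite sqnormDZ -/b.
have -> : dot x (v - x) = - a.
  by rewrite -scaleN1r dotC dotDl dotZl [dot v x]dotC /a /sqnorm; ring.
nra.
Qed.

(** Barany's argument. Among all choices [c] of one point per color, take one
    whose convex hull comes closest to the origin, at [x = l (W c)]. Suppose
    [x <> 0]. Minimality gives [<x, w j (c j)> >= |x|^2] for all [j], with
    equality where [l j <> 0]. As there are more colors than dimensions, [x] is
    also a combination that does not use some color [k]. The hull of color [k]
    contains the origin, so it has a point [v] with [<x, v> <= 0]; choosing
    [v] for color [k] keeps [x] in the hull, and [x] can then be moved towards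
    [v], which brings it closer to the origin. *)
Theorem colorful_caratheodory (F : realFieldType) n m (I : finType)
    (w : 'I_n -> I -> 'rV[F]_m) :
  (m < n)%N ->
  (forall j, exists mu : I -> F,
      [/\ forall i, 0 <= mu i, \sum_i mu i = 1
        & \sum_i mu i *: w j i = 0]) ->
  exists c : 'I_n -> I, exists2 l : 'rV[F]_n, simplex [set: 'I_n]%SET l
    & \sum_j l 0 j *: w j (c j) = 0.
Proof.
move=> lt_mn hull0.
pose W (c : 'I_n -> I) : 'M[F]_(n, m) := \matrix_j w j (c j).
have WE c l : l *m W c = \sum_j l 0 j *: w j (c j).
  by rewrite mulmx_sum_row; under eq_bigr do rewrite rowK.
have half x j : x != 0 -> exists i, dot x (w j i) <= 0.
  move=> x_neq0; have [mu [mu_ge0 smu muw]] := hull0 j.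
  have [//|no_i] := pselect (exists i, dot x (w j i) <= 0).
  have dot_gt0 i : 0 < dot x (w j i).
    by rewrite ltNge; apply/negP => le0; apply: no_i; exists i.
  have : \sum_i mu i * dot x (w j i) = 0.
    rewrite -[RHS](_ : dot (\sum_i mu i *: w j i) x = 0).
      by rewrite dot_suml; apply: eq_bigr => i _; rewrite dotZl dotC.
    by rewrite muw /dot mul0mx mxE.
  move/eqP; rewrite psumr_eq0 => [/allP mu0|i _]; last first.
    by rewrite mulr_ge0 // ltW.
  have [i /negPf mui] := sum1_exists_neq0 smu.
  by have /= := mu0 i (mem_index_enum i); rewrite mulf_eq0 mui gt_eqF.
have n_gt0 : (0 < n)%N by apply: leq_ltn_trans lt_mn.
pose j0 := Ordinal n_gt0.
have [_ [_ /sum1_exists_neq0[i0 _] _]] := hull0 j0.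
have /choice[L LP] : forall c : {ffun 'I_n -> I}, exists l : 'rV[F]_n,
    simplex [set: 'I_n]%SET l /\ forall l', simplex [set: 'I_n]%SET l' ->
      sqnorm (l *m W c) <= sqnorm (l' *m W c).
  move=> c; have [|l lS lmin] := min_norm_simplex (W c) (J := [set: 'I_n]%SET).
    by apply/finset.set0Pn; exists j0; rewrite finset.in_setT.
  by exists l.
case: (@Order.TotalTheory.arg_minP _ _ _ [ffun=> i0] xpredT
  (fun c => sqnorm (L c *m W c)) isT) => c _ minc.
have [lS _] := LP c; move: lS minc; set l := L c => lS minc.
exists c, l; rewrite // -WE; set x := l *m W c.
apply/eqP/negPn/negP => x_neq0.
have no_descent (c' : {ffun 'I_n -> I}) l' j : simplex [set: 'I_n]%SET l' ->
    l' *m W c' = x -> sqnorm x <= dot x (w j (c' j)).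
  move=> l'S l'x; rewrite leNgt; apply/negP => /sqnorm_descent[t [t0 t1]].
  rewrite ltNge => /negP; apply.
  apply: le_trans (minc c' isT) _.
  have [_ Lmin] := LP c'.
  have := Lmin _ (simplex_segment l'S (simplex_vertex F (finset.in_setT j))
                        t0 t1).
  by rewrite mulmxDl -scalemxAl mulmxBl l'x -rowE rowK.
(* When all weights are nonzero, all chosen points lie on <x, y> = |x|^2, so
   the weights of a linear dependence between them sum to 0; adding a multiple
   of the dependence to l fixes x and makes some weight vanish. *)
have [k [l' [l'S l'x l'k]]] : exists k l',
    [/\ simplex [set: 'I_n]%SET l', l' *m W c = x & l' 0 k = 0].
  have [[k lk]|l_neq0] := pselect (exists k, l 0 k = 0); first by exists k, l.
  have [l_ge0 sl _] := lS.
  have dot_w j : dot x (w j (c j)) = sqnorm x.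
    have : \sum_j l 0 j * (dot x (w j (c j)) - sqnorm x) = 0.
      under eq_bigr do rewrite mulrBr.
      rewrite sumrB -mulr_suml sl mul1r; apply/eqP; rewrite subr_eq0; apply/eqP.
      rewrite /sqnorm [in RHS]/dot {2}/x WE -[RHS]/(dot _ x) dot_suml.
      by apply: eq_bigr => j' _; rewrite dotZl dotC.
    move/eqP; rewrite psumr_eq0 => [/allP /(_ j (mem_index_enum j))|j' _] /=.
      rewrite mulf_eq0 subr_eq0 => /orP[/eqP lj|/eqP //].
      by case: l_neq0; exists j.
    by rewrite mulr_ge0 // subr_ge0; exact: no_descent lS _.
  have : kermx (W c) != 0.
    rewrite kermx_eq0 /row_free neq_ltn.
    by rewrite (leq_ltn_trans (rank_leq_col _) lt_mn).
  case/rowV0Pn=> mu /sub_kermxP mu0 mu_neq0.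
  have smu : \sum_j mu 0 j = 0.
    have : \sum_j mu 0 j * sqnorm x = 0.
      rewrite -[RHS](_ : dot (mu *m W c) x = 0).
        rewrite WE dot_suml; apply: eq_bigr => j _.
        by rewrite dotZl dotC dot_w.
      by rewrite mu0 /dot mul0mx mxE.
    move/eqP; rewrite -mulr_suml mulf_eq0 sqnorm_eq0 (negPf x_neq0) orbF.
    by move/eqP.
  have [[i mui]|mu_ge0] := pselect (exists i, mu 0 i < 0); last first.
    case/negP: mu_neq0; move/eqP: smu; rewrite psumr_eq0 => [/allP mu0'|j _].
      apply/eqP/rowP => j; rewrite mxE.
      by apply/eqP; exact: mu0' (mem_index_enum j).
    by rewrite leNgt; apply/negP => muj; apply: mu_ge0; exists j.
  have [t [_ lt_ge0 [k _ ltk]]] := ratio_test l_ge0 mui.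
  exists k, (l + t *: mu); split=> //.
    split=> // [|j]; last by rewrite finset.in_setT.
    under eq_bigr do rewrite !mxE.
    by rewrite big_split /= -mulr_sumr sl smu mulr0 addr0.
  by rewrite mulmxDl -scalemxAl mu0 scaler0 addr0.
have [i le0] := half x k x_neq0.
pose c' := [ffun j => if j == k then i else c j].
have l'x' : l' *m W c' = x.
  rewrite -l'x !WE; apply: eq_bigr => j _; rewrite ffunE.
  by case: eqP => // ->; rewrite l'k !scale0r.
have := no_descent c' l' k l'S l'x'; rewrite ffunE eqxx => /le_trans /(_ le0).
by rewrite leNgt lt_def sqnorm_eq0 x_neq0 sqnorm_ge0.
Qed.

(** * Tverberg's theorem for cones *)

(** Sarkaria's tensor trick. The vectors [v i], for [i <= s], of an
    [s]-dimensional space sum to zero and satisfy no other linear relation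
    (up to scaling). The first property puts the origin in the convex hull of
    the [a_j (x) v i] for each column [a_j], in dimension [d * s], so the
    colorful theorem gives a coloring [c] and weights with
    [\sum_j l_j a_j (x) v (c j) = 0]. Grouping by color, the vectors
    [y_i = \sum_(c j = i) l_j a_j] satisfy [\sum_i y_i (x) v i = 0], and the
    second property makes them all equal. *)
Theorem conic_tverberg (F : realFieldType) d s k (A : 'M[F]_(d, k)) :
  (d * s < k)%N ->
  exists c : 'I_k -> 'I_s.+1, exists2 l : 'rV[F]_k, simplex [set: 'I_k]%SET l
    & forall i, \sum_(j | c j == i) l 0 j *: col j A
                = \sum_(j | c j == ord0) l 0 j *: col j A.
Proof.
move=> lt_k.
(* v 0 = (-1, .., -1), and the other v i are the standard basis vectors. *)
pose v (i : 'I_s.+1) (b : 'I_s) : F := (i == lift ord0 b)%:R - (i == ord0)%:R.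
have sum_pred1 (i : 'I_s.+1) : \sum_i' (i' == i)%:R = 1 :> F.
  by rewrite (bigD1 i) //= eqxx big1 ?addr0 // => i' /negPf->.
have sumv b : \sum_i v i b = 0 by rewrite sumrB !sum_pred1 subrr.
pose M j i : 'M[F]_(d, s) := \matrix_(a, b) (A a j * v i b).
have [j|c [l lS]] := @colorful_caratheodory F k (d * s)%N _
    (fun j i => mxvec (M j i)) lt_k.
  exists (fun=> s.+1%:R^-1); split=> [i||].
  - by rewrite invr_ge0 ler0n.
  - by rewrite sumr_const card_ord -[_ *+ _]mulr_natr mulVf ?pnatr_eq0.
  - rewrite -scaler_sumr -linear_sum (_ : \sum_i M j i = 0) ?raddf0 ?scaler0 //.
    apply/matrixP => a b; rewrite summxE mxE; under eq_bigr do rewrite mxE.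
    by rewrite -mulr_sumr sumv mulr0.
under eq_bigr do rewrite -linearZ.
rewrite -linear_sum => /(congr1 vec_mx); rewrite mxvecK raddf0 => lM.
exists c, l => // i; have [b ->|->//] := unliftP ord0 i.
apply/matrixP => a z; rewrite !summxE; apply/eqP; rewrite -subr_eq0; apply/eqP.
rewrite big_mkcond [X in _ - X]big_mkcond -sumrB /=.
move/matrixP: lM => /(_ a b); rewrite summxE [RHS]mxE => lM.
rewrite -[RHS]lM; apply: eq_bigr => j _; rewrite !mxE /v.
by case: (c j == _); case: (c j == _); rewrite /=; ring.
Qed.

(** * From rational weights to integer solutions *)

Lemma clear_denominators n (q : 'rV[rat]_n) :
  exists2 N : nat, (0 < N)%N
    & exists x : 'cV[int]_n, forall j, (x j 0)%:~R = N%:R * q 0 j.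
Proof.
exists (\prod_j `|denq (q 0%R j)|)%N.
  by rewrite prodn_gt0 // => j; rewrite absz_gt0 denq_neq0.
exists (\col_j (numq (q 0 j) *
  (\prod_(i | i != j) `|denq (q 0%R i)|)%N%:Z)) => j.
rewrite mxE [in RHS](bigD1 j) //= rmorphM /= natrM mulrAC.
have -> : (`|denq (q 0%R j)|%N)%:R = (denq (q 0 j))%:~R :> rat.
  by rewrite -[in RHS]absz_denq.
by rewrite [_%:~R * q 0 j]mulrC -numqE.
Qed.

(** In a relation [A x = 0] with [x >= 0], a column used with a positive
    coefficient has its opposite in the semigroup, which therefore contains
    the group of all integer multiples of that column. *)
Lemma pointed_kernel (d k : nat) (A : 'M[int]_(d, k)) (x : 'cV[int]_k) j :
  pointed_semigroup (Sg A) -> nonneg_vec x -> A *m x = 0 -> 0 < x j 0 ->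
  col j A = 0.
Proof.
move=> pointedA x_ge0 Ax0 xj_gt0.
pose H : set 'cV[int]_d := [set p | exists z : int, p = z *: col j A]%classic.
have H1 : H (col j A) by exists 1; rewrite scale1r.
suff H0 : H = [set 0]%classic by move: H1; rewrite H0.
apply: pointedA.
  split; first by rewrite inE; exists 0; rewrite scale0r.
  move=> p q; rewrite !inE => -[z ->] [z' ->].
  by exists (z - z'); rewrite scalerBl.
move=> p [z ->]; rewrite colE scalemxAr.
have [z_ge0|z_lt0] := leP 0 z.
  exists (z *: delta_mx j 0) => // i; rewrite !mxE.
  by rewrite mulr_ge0 // ler0n.
exists (- z *: (x - delta_mx j 0)).
  move=> i; rewrite !mxE; apply: mulr_ge0; first by rewrite oppr_ge0 ltW.
  rewrite subr_ge0 andbT.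
  have [->|_] := eqVneq i j; last exact: x_ge0.
  by [].
by rewrite -!scalemxAr mulmxBr Ax0 sub0r scalerN scaleNr opprK.
Qed.

(* The zero vector is the monochromatic solution of every color for p = 0, so
   the content of the conclusion is that p can be taken nonzero. This can fail
   when some generator is 0 (take d = 1, r = 2 and the generators 0 and 1), so
   p != 0 is asserted for nonzero generators. *)
Theorem corollary2p8 (d k r : nat) (A : 'M[int]_(d, k))
    (r_gt0 : (0 < r)%N)
    (pointedA : pointed_semigroup (Sg A))
    (k_ge : (d * (r - 1) + 1 <= k)%N) :
  exists c : 'I_k -> 'I_r, exists p : 'cV[int]_d,
    [/\ Sg A p,
        forall i : 'I_r, has_monochromatic_solution A c i p
      & (forall j : 'I_k, col j A != 0) -> p != 0].
Proof.
case: r r_gt0 k_ge => // s _; rewrite subn1 addn1 /= => lt_k.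
have [c [l [l_ge0 sl _] lc]] :=
  conic_tverberg (map_mx intr A : 'M[rat]_(d, k)) lt_k.
have [N N_gt0 [x xE]] := clear_denominators l.
have x_ge0 : nonneg_vec x.
  by move=> j; rewrite -(ler0z rat) xE mulr_ge0 // ler0n.
pose y i : 'cV[int]_k := \col_j (if c j == i then x j 0 else 0).
have y_ge0 i : nonneg_vec (y i).
  by move=> j; rewrite mxE; case: ifP => // _; exact: x_ge0.
have AyE i : map_mx intr (A *m y i) = N%:R *:
    \sum_(j | c j == i) l 0 j *: col j (map_mx intr A) :> 'cV[rat]_d.
  apply/matrixP => a z; rewrite !mxE summxE rmorph_sum mulr_sumr.
  rewrite [RHS]big_mkcond; apply: eq_bigr => j _; rewrite !mxE rmorphM /=.
  by case: ifP => _; rewrite ?mulr0 // xE; ring.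
have Ay i : A *m y i = A *m y ord0.
  have /matrixP eqA := etrans (AyE i) (etrans (congr1 _ (lc i))
    (esym (AyE ord0))).
  apply/matrixP => a z; apply: (@intr_inj rat).
  by have := eqA a z; rewrite !mxE.
exists c, (A *m y ord0); split; first by exists (y ord0).
  move=> i; exists (y i); split=> //.
  apply/fintype.subsetP => j; rewrite !finset.inE mxE.
  by case: ifP => //; rewrite eqxx.
move=> A_neq0; apply/eqP => Ay0.
have Ax0 : A *m x = 0.
  have -> : x = \sum_i y i.
    apply/matrixP => j z; rewrite ord1 summxE (bigD1 (c j)) //= mxE eqxx.
    by rewrite big1 ?addr0 // => i /negPf ci; rewrite mxE eq_sym ci.
  by rewrite mulmx_sumr big1 // => i _; rewrite Ay.
have [j lj] := sum1_exists_neq0 sl.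
have xj : 0 < x j 0.
  rewrite lt_def x_ge0 andbT -(intr_eq0 rat) xE mulf_neq0 //.
  by rewrite pnatr_eq0 -lt0n.
by have /eqP := A_neq0 j; apply; exact: pointed_kernel xj.
Qed.
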